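(* Let $F$ be a commutative field with $|F|>2$ and let $n\ge 2$. If $|F|\neq 3$ or $n\neq 2$, then the existence of a quadratic embedding of $\mathrm{PG}(n,F)$ into $\mathrm{PG}(n',F')$ implies that the field $F$ is isomorphic to a subfield of $F'$.
   Context: $F$ is a commutative field; $F'$ is a field, not assumed to be commutative. $\mathrm{PG}(n,F)=(\mathcal P,\mathcal L)$ and $\mathrm{PG}(n',F')=(\mathcal P',\mathcal L')$ are the projective spaces of (finite) projective dimension $n$, $n'$ over $F$, $F'$, with point sets $\mathcal P,\mathcal P'$ and line sets $\mathcal L,\mathcal L'$. The symbol $\subset$ allows equality. A quadric of $\mathrm{PG}(n,F)$ is the set of zeros in $\mathcal P$ of a non-zero quadratic form on $F^{n+1}$. Let $\Phi=\{\mathcal S\subset\mathcal P \mid \mathcal S \text{ is a quadric of } \mathrm{PG}(n,F)\}\cup\{\mathcal P\}$. For $\mathcal M\subset\mathcal P$ the quadratic closure is $\overline{\overline{\mathcal M}}=\bigcap_{\mathcal M\subset\mathcal S,\ \mathcal S\in\Phi}\mathcal S$. For a set $\mathcal X$ of points of a projective space, $\overline{\mathcal X}$ denotes its linear closure (the smallest subspace containing it). Maps are written as right exponents: $\mathcal M^\nu$ is the image of $\mathcal M$ and $(\cdot)^{\nu^{-1}}$ is the preimage. A map $\nu:\mathcal P\to\mathcal P'$ is a quadratic embedding of $\mathrm{PG}(n,F)$ into $\mathrm{PG}(n',F')$ if $\overline{\overline{\mathcal M}}=(\overline{\mathcal M^\nu})^{\nu^{-1}}$ for all $\mathcal M\subset\mathcal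 P$, and $\overline{\operatorname{im}\nu}=\mathcal P'$. *)

(* Defs.v *)
From HB Require Import structures.
From mathcomp Require Import all_boot all_order all_algebra.
From mathcomp Require Import boolp classical_sets functions cardinality.

Set Implicit Arguments.
Unset Strict Implicit.
Unset Printing Implicit Defensive.

Import GRing.Theory.

Local Open Scope classical_set_scope.
Local Open Scope ring_scope.

(* The multiplication of R need not be commutative. *)
Definition division_ring (R : unitRingType) : Prop :=
  forall x : R, x != 0 -> x \is a GRing.unit.

(* The boolean predicate K is no restriction: logic is classical. *)
Definition isomorphic_to_subfield (F : fieldType) (F' : unitRingType) : Prop :=
  exists (K : {pred F'}) (f : {rmorphism F -> F'}),
    [/\ GRing.divring_closed K, injective f
      & forall y : F', y \in K <-> exists x : F, f x = y].

(* A point of PG(n, R) is a one-dimensional subspace of the left R-vector space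
   of row vectors of length n + 1, given as a set of vectors; two points with
   the same vectors are equal by proof irrelevance. *)
Record pg_point (R : unitRingType) (n : nat) := PGPoint {
  vectors : set 'rV[R]_n.+1;
  vectorsP : exists2 v : 'rV[R]_n.+1, v != 0 &
               vectors = [set a *: v | a in [set: R]] }.

Section ProjectiveSpace.
Variables (R : unitRingType) (n : nat).
Implicit Types (p q r : pg_point R n) (M S : set (pg_point R n)).

(* The right-hand side is the sum of p and q as subspaces of the vector space,
   which has dimension two when p <> q. *)
Definition joining_line p q : set (pg_point R n) :=
  [set r : pg_point R n |
    vectors r `<=` [set u + v | u in vectors p & v in vectors q]].

Definition pg_lines : set (set (pg_point R n)) :=
  [set l | exists p q, p <> q /\ l = joining_line p q].

Definition pg_subspace S : Prop :=
  forall l, pg_lines l ->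
    (exists p q, [/\ p <> q, (l `&` S) p & (l `&` S) q]) -> l `<=` S.

Definition linear_closure M : set (pg_point R n) := smallest pg_subspace M.

End ProjectiveSpace.

Section Quadrics.
Variables (F : fieldType) (n : nat).

Definition quadratic_form (q : 'rV[F]_n.+1 -> F) : Prop :=
  (forall (a : F) (v : 'rV[F]_n.+1), q (a *: v) = a ^+ 2 * q v) /\
  bilinear_for *%R *%R (fun u v : 'rV[F]_n.+1 => q (u + v) - q u - q v).

Definition quadric (S : set (pg_point F n)) : Prop :=
  exists q : 'rV[F]_n.+1 -> F,
    [/\ quadratic_form q, exists v, q v != 0
      & S = [set p : pg_point F n | forall v, vectors p v -> q v = 0]].

Definition Phi : set (set (pg_point F n)) := quadric `|` [set setT].

Definition quadratic_closure (M : set (pg_point F n)) : set (pg_point F n) :=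
  \bigcap_(S in [set S | Phi S /\ M `<=` S]) S.

End Quadrics.

Definition quadratic_embedding (F : fieldType) (n : nat) (F' : unitRingType)
    (n' : nat) (nu : pg_point F n -> pg_point F' n') : Prop :=
  (forall M : set (pg_point F n),
     quadratic_closure M = nu @^-1` linear_closure (nu @` M)) /\
  linear_closure (range nu) = setT.

(* Main.v *)
From HB Require Import structures.
Require Import Defs.
From mathcomp Require Import all_boot all_order all_algebra.
From mathcomp Require Import boolp classical_sets functions cardinality.
From mathcomp Require Import finmap ring.

(* Let H be a hyperplane. A quadric through H is the union of H with another
   hyperplane, so that contracting nu(H), i.e. dividing F'^(n'+1) by its span, turns
   nu into a map which embeds the affine space AG(n, F) = PG(n, F) \ H into a
   projective space over F' and preserves both dependence and independence. Under
   it the lines of a parallel class of a plane become concurrent: if |F| > 3 by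
   Desargues' theorem inside the plane, if n > 2 because parallel lines are pairwise
   coplanar and an auxiliary one can be chosen outside the plane. With the
   horizontal and vertical points at infinity as part of a frame, (x, y) gets
   coordinates (1, f(x), g(y)). The line y = x gives f = g, the lines y = m x give
   that f is multiplicative, and x + y = 1 gives f(x) + f(1 - x) = 1, whence f is
   additive. *)

Set Implicit Arguments.
Unset Strict Implicit.
Unset Printing Implicit Defensive.

Import GRing.Theory.

Local Open Scope classical_set_scope.
Local Open Scope ring_scope.

(** * Quotients of modules by submodules *)

Definition submodule (R : pzRingType) (W : lmodType R) (U : set W) : Prop :=
  U 0 /\ forall a u v, U u -> U v -> U (a *: u + v).

Section SubmoduleQuotient.

Local Open Scope quotient_scope.

Variables (R : pzRingType) (W : lmodType R) (U : set W).
Hypothesis subU : submodule U.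

Let inU : {pred W} := fun w => `[< U w >].

Let inU_closed : submod_closed inU.
Proof.
split; first by apply/asboolP; case: subU.
by move=> a u v /asboolP Uu /asboolP Uv; apply/asboolP/(proj2 subU).
Qed.

HB.instance Definition _ := GRing.isSubmodClosed.Build R W inU inU_closed.

Let Q : zmodType := Quotient.quot inU.
Let scaleQ (a : R) (x : Q) : Q := \pi_Q (a *: repr x).

Let piQ w w' : (\pi_Q w = \pi_Q w') <-> U (w - w').
Proof.
by split=> [/eqP|Uw]; [|apply/eqP]; rewrite -Quotient.idealrBE;
  [move/asboolP|apply/asboolP].
Qed.

Let piD w w' : \pi_Q (w + w') = \pi_Q w + \pi_Q w'.
Proof. exact: raddfD. Qed.

Let pi_scale a w : \pi_Q (a *: w) = scaleQ a (\pi_Q w).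
Proof.
apply/piQ; rewrite -scalerBr -[X in U X]addr0.
apply: (proj2 subU); last exact: (proj1 subU).
by apply/piQ; rewrite reprK.
Qed.

(** Scalars act on the quotient group through representatives; by [pi_scale] this does not depend on
    their choice, so that each module law descends along the surjection [\pi_Q]. *)
Lemma submodule_quotient :
  exists (Q' : lmodType R) (pi : {linear W -> Q'}), forall w, pi w = 0 <-> U w.
Proof.
have sA a b v : scaleQ a (scaleQ b v) = scaleQ (a * b) v.
  by rewrite -[v]reprK -!pi_scale scalerA.
have s1 : left_id 1 scaleQ by move=> v; rewrite -[v]reprK -!pi_scale scale1r.
have sDr : right_distributive scaleQ +%R.
  by move=> a u v; rewrite -[u]reprK -[v]reprK -piD -!pi_scale scalerDr piD.
have sDl v : {morph scaleQ^~ v : a b / a + b}.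
  by move=> a b; rewrite -[v]reprK -!pi_scale scalerDl piD.
pose mixQ := GRing.Zmodule_isLmodule.Build R Q sA s1 sDr sDl.
pose Q' : lmodType R := HB.pack Q mixQ.
pose pi : W -> Q' := \pi_Q.
have lin_pi : linear pi by move=> a u v; rewrite /pi piD pi_scale.
pose mixpi := GRing.isLinear.Build R W Q' *:%R pi lin_pi.
pose lpi : {linear W -> Q'} := HB.pack pi mixpi.
exists Q', lpi => w; rewrite -[X in U X]subr0 -piQ.
by rewrite /lpi /= /pi raddf0.
Qed.
End SubmoduleQuotient.

(** * Lines as spans of two vectors over a division ring *)

Section DivisionModule.
Variables (R : unitRingType) (hR : division_ring R) (W : lmodType R).
Implicit Types (p q r s : W) (S : set W).

Definition span2 p q : set W := [set r | exists a b : R, r = a *: p + b *: q].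

Lemma submoduleZ S a p : submodule S -> S p -> S (a *: p).
Proof. by case=> S0 SD Sp; rewrite -[_ *: _]addr0; apply: SD. Qed.

Lemma submoduleB S p q : submodule S -> S p -> S q -> S (p - q).
Proof. by case=> S0 SD Sp Sq; rewrite addrC -scaleN1r; apply: SD. Qed.

Lemma span2_submodule p q : submodule (span2 p q).
Proof.
split; first by exists 0, 0; rewrite !scale0r addr0.
move=> a _ _ [b [c ->]] [b' [c' ->]]; exists (a * b + b'), (a * c + c').
by rewrite scalerDr !scalerDl !scalerA addrACA.
Qed.

Lemma span2_sub S p q : submodule S -> S p -> S q -> span2 p q `<=` S.
Proof.
by move=> subS Sp Sq _ [a [b ->]]; apply: (proj2 subS) => //; apply: submoduleZ.
Qed.

Lemma span2l p q : span2 p q p.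
Proof. by exists 1, 0; rewrite scale1r scale0r addr0. Qed.

Lemma span2r p q : span2 p q q.
Proof. by exists 0, 1; rewrite scale1r scale0r add0r. Qed.

Lemma span2C p q : span2 p q = span2 q p.
Proof.
by apply/seteqP; split; apply: span2_sub;
  (exact: span2_submodule || exact: span2l || exact: span2r).
Qed.

Lemma division_mulf_neq0 (a b : R) : a != 0 -> b != 0 -> a * b != 0.
Proof.
move=> a0; apply: contra => /eqP ab0.
by rewrite -(mulKr (hR a0) b) ab0 mulr0.
Qed.

Lemma divKscale a p : a != 0 -> a^-1 *: (a *: p) = p.
Proof. by move=> a0; rewrite scalerA mulVr ?scale1r // hR. Qed.

Lemma scale_solve a p q : a != 0 -> q = a *: p -> p = a^-1 *: q.
Proof. by move=> a0 ->; rewrite divKscale. Qed.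

Lemma scaler_eq0P a p : p <> 0 -> a *: p = 0 -> a = 0.
Proof.
move=> p0 ap0; apply/eqP/negPn/negP => a0; apply: p0.
by rewrite -(divKscale p a0) ap0 scaler0.
Qed.

Lemma span2_exchange p q r :
  span2 p q r -> ~ (exists a, r = a *: p) -> span2 p r q.
Proof.
case=> a [b ->] np; have [b0|b0] := eqVneq b 0.
  by case: np; exists a; rewrite b0 scale0r addr0.
exists (- (b^-1 * a)), b^-1.
by rewrite scalerDr divKscale // scalerA scaleNr addKr.
Qed.

(** Two steps of Steinitz exchange: r replaces q, or p if r is a multiple of p; then s replaces the
    remaining generator. *)
Lemma span2_basis p q r s : span2 p q r -> span2 p q s -> r <> 0 ->
  ~ (exists a, s = a *: r) -> span2 p q `<=` span2 r s.
Proof.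
move=> pqr pqs r0 nrs.
have [[a ra]|npr] := pselect (exists a, r = a *: p).
  have a0 : a != 0 by apply/eqP => a0; apply: r0; rewrite ra a0 scale0r.
  have rsp : span2 r s p.
    by exists a^-1, 0; rewrite scale0r addr0; apply: scale_solve.
  apply: span2_sub => //; first exact: span2_submodule.
  apply: span2_exchange => //; apply: span2_sub pqs => //.
  - exact: span2_submodule.
  - by exists a^-1, 0; rewrite scale0r addr0; apply: scale_solve.
  - exact: span2r.
have prq := span2_exchange pqr npr.
have rsp : span2 r s p.
  apply: span2_exchange => //; rewrite span2C; apply: span2_sub pqs => //.
  - exact: span2_submodule.
  - exact: span2l.
apply: span2_sub => //; first exact: span2_submodule.
by apply: span2_sub prq => //; [exact: span2_submodule|exact: span2l].
Qed.

(** A line that is not contained in a subspace meets it in at most one point: independent k' and k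
    would span the whole line and force p into S. *)
Lemma span2_meet S p q k k' : submodule S -> ~ S p ->
  span2 p q k -> S k -> span2 p q k' -> S k' -> k' <> 0 ->
  exists c, k = c *: k'.
Proof.
move=> subS Sp pqk Sk pqk' Sk' k'0; apply: contrapT => nk; apply: Sp.
apply: (span2_sub subS Sk' Sk).
by apply: (span2_basis pqk' pqk) => //; apply: span2l.
Qed.

Definition free3 p q r := forall a b c : R,
  a *: p + b *: q + c *: r = 0 -> [/\ a = 0, b = 0 & c = 0].

Lemma free3_inj p q r a b c a' b' c' : free3 p q r ->
  a *: p + b *: q + c *: r = a' *: p + b' *: q + c' *: r ->
  [/\ a = a', b = b' & c = c'].
Proof.
move=> fr /eqP; rewrite -subr_eq0 !opprD addrACA [X in X + _]addrACA -!scalerBl.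
by move=> /eqP /fr [/subr0_eq -> /subr0_eq -> /subr0_eq ->].
Qed.

End DivisionModule.

(** * Embeddings of the affine plane: frames, coordinates, ring homomorphism *)

Section AffinePlane.
Variables (F : fieldType) (R : unitRingType) (hR : division_ring R).
Variable W : lmodType R.

(** Points of the projective space are given by arbitrary representing vectors. The two spanning
    points may coincide, whence values at different points are not proportional and no value is
    zero. *)
Definition affine_plane_embedding (e : F -> F -> W) : Prop :=
  forall x1 y1 x2 y2 x y, span2 (e x1 y1) (e x2 y2) (e x y) <->
    exists t, x = (1 - t) * x1 + t * x2 /\ y = (1 - t) * y1 + t * y2.

(** The point at infinity of the horizontal lines; the vertical direction is treated by exchanging
    the arguments of [e]. *)
Definition common_point (e : F -> F -> W) (h : W) : Prop :=
  h <> 0 /\ forall x x' y, x != x' -> span2 (e x y) (e x' y) h.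

Lemma affine_plane_flip e : affine_plane_embedding e ->
  affine_plane_embedding (fun x y => e y x).
Proof. by move=> he x1 y1 x2 y2 x y; rewrite he; split=> -[t []]; exists t. Qed.

Lemma affine_plane_inj e x y x' y' c : affine_plane_embedding e ->
  e x y = c *: e x' y' -> x = x' /\ y = y'.
Proof.
move=> he exy.
have [|t [-> ->]] := (he x' y' x' y' x y).1.
  by exists c, 0; rewrite scale0r addr0.
by split; ring.
Qed.

Lemma affine_plane_neq0 e x y : affine_plane_embedding e -> e x y <> 0.
Proof.
move=> he e0.
have /(affine_plane_inj he)[_] : e x y = 0 *: e x (y + 1) by rewrite scale0r.
by move/eqP; rewrite -subr_eq0 opprD addNKr oppr_eq0 oner_eq0.
Qed.

(** Since h is also on the image of the parallel through (x, y + 1), a multiple of [e x y] would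
    place (x, y) on that parallel. *)
Lemma common_point_notin e h x y c : affine_plane_embedding e ->
  common_point e h -> h <> c *: e x y.
Proof.
move=> he [h0 hh] hc.
have c0 : c != 0 by apply/eqP => c0; apply: h0; rewrite hc c0 scale0r.
have := hh 0 1 (y + 1); rewrite eq_sym oner_neq0 => /(_ isT) spn.
have [|t [_]] := (he 0 (y + 1) 1 (y + 1) x y).1.
  by rewrite (scale_solve hR c0 hc); apply: submoduleZ => //; exact: span2_submodule.
move/eqP; rewrite -subr_eq0.
have -> : y - ((1 - t) * (y + 1) + t * (y + 1)) = - 1 by ring.
by rewrite oppr_eq0 oner_eq0.
Qed.

Lemma common_point_along e h x x' y : affine_plane_embedding e ->
  common_point e h -> exists a b, a != 0 /\ e x' y = a *: e x y + b *: h.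
Proof.
move=> he hh; have [<-|xx'] := eqVneq x x'.
  by exists 1, 0; rewrite oner_neq0 scale1r scale0r addr0.
have [||a [b eab]] := span2_exchange hR (q := e x' y) (p := e x y) (r := h).
- exact: hh.2.
- by case=> c; apply: common_point_notin.
exists a, b; split=> //; apply/eqP => a0.
have b0 : b != 0.
  apply/eqP => b0; apply: (affine_plane_neq0 (x := x') (y := y) he).
  by rewrite eab a0 b0 !scale0r addr0.
apply: (common_point_notin (x := x') (y := y) (c := b^-1) he hh).
by apply: (scale_solve hR) => //; rewrite eab a0 scale0r add0r.
Qed.

(** If v were on the image of the X-axis, then so would be (0, 1), which is joined to (0, 0) by a
    line through v. *)
Lemma common_points_free e h v : affine_plane_embedding e ->
  common_point e h -> common_point (fun x y => e y x) v ->
  free3 (e 0 0) h v.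
Proof.
move=> he hh hv a b c abc0.
have he' := affine_plane_flip he.
have h01 : (0 : F) != 1 by rewrite eq_sym oner_neq0.
have c0 : c = 0.
  apply/eqP/negPn/negP => c0.
  have S1 : span2 (e 0 0) (e 1 0) v.
    have -> : v = - c^-1 *: (a *: e 0 0 + b *: h).
      rewrite -(divKscale hR v c0) scaleNr -scalerN; congr (_ *: _).
      by apply/eqP; rewrite -addr_eq0 addrC abc0.
    have subS := @span2_submodule R W (e 0 0) (e 1 0).
    apply: submoduleZ => //; apply: (proj2 subS).
      exact: span2l.
    by apply: submoduleZ => //; apply: hh.2.
  have [a1 [b1 [a10 e01]]] := common_point_along 1 0 0 he' hv.
  have [|t [_]] := (he 0 0 1 0 0 1).1.
    have := common_point_along 0 1 0 he' hv => -[a2 [b2 [_ ->]]].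
    have subS := @span2_submodule R W (e 0 0) (e 1 0).
    apply: (proj2 subS); first exact: span2l.
    exact: submoduleZ.
  by rewrite !mulr0 addr0 => /eqP; rewrite oner_eq0.
move: abc0; rewrite c0 scale0r addr0 => ab0.
have b0 : b = 0.
  apply/eqP/negPn/negP => b0.
  apply: (common_point_notin (x := 0) (y := 0) (c := - (b^-1 * a)) he hh).
  rewrite scaleNr -scalerA -(divKscale hR h b0) -scalerN; congr (_ *: _).
  by apply/eqP; rewrite -addr_eq0 addrC ab0.
split=> //; apply: (scaler_eq0P hR) (affine_plane_neq0 (x := 0) (y := 0) he) _.
by rewrite -ab0 b0 scale0r addr0.
Qed.

(** The point (x, y) is reached from (0, y) along h and from (x, 0) along v. Comparing both
    expressions in the frame shows that, relative to the coefficient of O, that of h depends on x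
    only and that of v on y only. *)
Lemma affine_coordinates e h v : affine_plane_embedding e ->
  common_point e h -> common_point (fun x y => e y x) v ->
  exists (O h' v' : W) (f g : F -> R), [/\ free3 O h' v',
    forall x y, exists2 c, c != 0 & e x y = c *: (O + f x *: h' + g y *: v'),
    f 0 = 0 /\ g 0 = 0 & f 1 = 1 /\ g 1 = 1].
Proof.
move=> he hh hv; have he' := affine_plane_flip he.
have fr := common_points_free he hh hv; set O := e 0 0 in fr.
have axis e' h' : affine_plane_embedding e' -> common_point e' h' -> exists f : F -> R,
    forall x, exists2 a, a != 0 & e' x 0 = a *: (e' 0 0 + f x *: h').
  move=> he1 hh1; suff /choice[f0 f0P] : forall x, exists u : R,
      exists2 a, a != 0 & e' x 0 = a *: (e' 0 0 + u *: h') by exists f0.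
  move=> x.
  have [a [b [a0 ->]]] := common_point_along 0 x 0 he1 hh1.
  exists (a^-1 * b), a => //.
  by rewrite scalerDr !scalerA mulrA divrr ?mul1r // hR.
have [f fP] := axis _ _ he hh; have [g gP] := axis _ _ he' hv.
have eP x y : exists2 c, c != 0 & e x y = c *: (O + f x *: h + g y *: v).
  have [a [b [a0 e1]]] := common_point_along 0 x y he hh.
  have [a' [b' [a'0 e2]]] := common_point_along 0 y x he' hv.
  have [a1 a10 e3] := gP y; have [a2 a20 e4] := fP x.
  have E1 : e x y = (a * a1) *: O + b *: h + (a * a1 * g y) *: v.
    by rewrite e1 e3 scalerA scalerDr addrAC !scalerA.
  have E2 : e x y = (a' * a2) *: O + (a' * a2 * f x) *: h + b' *: v.
    by rewrite e2 e4 scalerA scalerDr !scalerA.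
  have [ca cb _] := free3_inj fr (etrans (esym E1) E2).
  exists (a * a1); last by rewrite E1 cb -ca !scalerDr !scalerA.
  exact: division_mulf_neq0.
have [f0 g0] : f 0 = 0 /\ g 0 = 0.
  have [c c0 e00] := eP 0 0.
  have [] := free3_inj (a := c^-1) (b := 0) (c := 0) (a' := 1) (b' := f 0) (c' := g 0) fr.
    by rewrite !scale0r !addr0 scale1r [in LHS]/O e00 divKscale.
  by move=> _ <- <-.
have f1 : f 1 != 0.
  apply/eqP => f10; have [c _ e1] := fP 1.
  have /(affine_plane_inj he)[/eqP] : e 1 0 = c *: e 0 0.
    by rewrite e1 f10 scale0r addr0.
  by rewrite oner_eq0.
have g1 : g 1 != 0.
  apply/eqP => g10; have [c _ e1] := gP 1.
  have /(affine_plane_inj he)[_ /eqP] : e 0 1 = c *: e 0 0.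
    by rewrite e1 g10 scale0r addr0.
  by rewrite oner_eq0.
(* Rescaling h and v moves the image of (1, 1) to the unit point of the frame. *)
exists O, (f 1 *: h), (g 1 *: v), (fun x => f x * (f 1)^-1), (fun y => g y * (g 1)^-1).
split; last 2 first.
- by rewrite f0 g0 !mul0r.
- by rewrite !divrr ?hR.
- move=> a b c; rewrite !scalerA => /fr[-> b0 c0]; split=> //.
    by rewrite -(mulrK (hR f1) b) b0 mul0r.
  by rewrite -(mulrK (hR g1) c) c0 mul0r.
- move=> x y; have [c c0 ->] := eP x y; exists c => //.
  by rewrite !scalerA !mulrVK ?hR.
Qed.

Lemma affine_plane_rmorphism e h v (x0 : F) : affine_plane_embedding e ->
  common_point e h -> common_point (fun x y => e y x) v ->
  x0 != 0 -> x0 != 1 ->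
  exists f : F -> R, [/\ f 1 = 1, {morph f : x y / x * y} & {morph f : x y / x + y}].
Proof.
move=> he hh hv x00 x01.
have [O [h' [v' [f [g [fr eP [f0 g0] [f1 g1]]]]]]] := affine_coordinates he hh hv.
(* A collinear triple satisfies the same relation in both coordinates; the coefficient of O,
   normalised to 1, gives a + b = 1. *)
have coll x1 y1 x2 y2 x y t : x = (1 - t) * x1 + t * x2 -> y = (1 - t) * y1 + t * y2 ->
    exists a b, [/\ a + b = 1, f x = a * f x1 + b * f x2 & g y = a * g y1 + b * g y2].
  move=> xE yE; have [a [b exy]] : span2 (e x1 y1) (e x2 y2) (e x y).
    by apply/he; exists t.
  have [c c0 e0] := eP x y; have [c1 _ e1] := eP x1 y1; have [c2 _ e2] := eP x2 y2.
  exists (c^-1 * a * c1), (c^-1 * b * c2).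
  have := @free3_inj _ _ _ _ _ 1 (f x) (g y) (c^-1 * a * c1 + c^-1 * b * c2)
    (c^-1 * a * c1 * f x1 + c^-1 * b * c2 * f x2)
    (c^-1 * a * c1 * g y1 + c^-1 * b * c2 * g y2) fr.
  case=> [|-> <- <-] //.
  rewrite scale1r -(divKscale hR (_ + _) c0) -e0 exy e1 e2.
  rewrite !scalerDr !scalerA !scalerDl -!mulrA.
  by rewrite addrACA; congr (_ + _); rewrite addrACA.
have fg x : g x = f x.
  have [||a [b []]] := coll 0 0 1 1 x x x; [by ring|by ring|].
  by rewrite f0 g0 f1 g1 !mulr0 !mulr1 !add0r => _ -> ->.
have fM : {morph f : x y / x * y}.
  move=> x y; have [||a [b []]] := coll 0 0 1 y x (x * y) x; [by ring|by ring|].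
  by rewrite f0 g0 f1 !mulr0 !mulr1 !add0r !fg => _ -> ->.
have f1D x : f x + f (1 - x) = 1.
  have [||a [b []]] := coll 0 1 1 0 x (1 - x) x; [by ring|by ring|].
  by rewrite f0 g0 f1 g1 !mulr0 !mulr1 add0r addr0 fg addrC => <- -> ->.
(* Scaling by x + y reduces the sum to the case x + y = 1. *)
have fD x y : x + y != 0 -> f (x + y) = f x + f y.
  move=> s0; have -> : f x = f (x + y) * f (x / (x + y)) by rewrite -fM mulrC divfK.
  have -> : f y = f (x + y) * f (1 - x / (x + y)) by rewrite -fM; congr f; field.
  by rewrite -mulrDr f1D mulr1.
(* The case of sum 0 cannot be scaled. Instead 1 and x0 - 1 have the non-zero sum x0, which settles
   the argument 1 - x0; since this is not 0, multiplicativity reaches every x. *)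
have fN x : f x + f (- x) = 0.
  have fN1 : f (1 - x0) + f (- (1 - x0)) = 0.
    have f1x0 : f (1 - x0) = 1 - f x0 by rewrite -(f1D x0) [RHS]addrC addKr.
    by rewrite f1x0 opprB -addrA addrCA -{1}f1 -fD ?subrKC // addrC subrr.
  have -> : x = x / (1 - x0) * (1 - x0) by rewrite divfK // subr_eq0 eq_sym.
  by rewrite -mulrN !fM -mulrDr fN1 mulr0.
exists f; split=> // x y; have [s0|] := eqVneq (x + y) 0; last exact: fD.
by rewrite s0 f0 (_ : y = - x) ?fN //; apply/eqP; rewrite -addr_eq0 addrC s0.
Qed.

(** * Concurrence of the images of parallel lines *)

(* The shear with axis Y = s maps the triangle (0, 0), (0, 1), (1, y) with vertices
   A0, A1, A2 on the three parallels to a triangle B0, B1, B2, and corresponding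
   sides meet in the points c01, c02, c12 of the axis. The triangles A0, B0, c02 and
   A1, B1, c12 are in perspective from c01, so that Desargues' theorem yields that
   the point of intersection of A0 B0 and A1 B1 is on A2 B2. *)
Lemma desargues_shear (e : F -> F -> W) (y s : F) : affine_plane_embedding e ->
  y != 0 -> y != 1 -> s != 0 -> s != 1 -> s != y ->
  exists2 h, h <> 0 &
    forall y', [\/ y' = 0, y' = 1 | y' = y] -> span2 (e 0 y') (e 1 y') h.
Proof.
move=> he y0 y1 s0 s1 sy.
(* The points at height s on the sides of the triangle (0, 0), (0, 1), (1, y); they are fixed by the
   shear, which takes (X, Y) to (X + Y - s, Y). *)
set c01 := e 0 s; set c02 := e (s / y) s; set c12 := e ((s - 1) / (y - 1)) s.
have y10 : y - 1 != 0 by rewrite subr_eq0.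
have s10 : s - 1 != 0 by rewrite subr_eq0.
have sy0 : y - s != 0 by rewrite subr_eq0 eq_sym.
have row x x' y' : span2 (e x y') (e x' y') `<=` span2 (e 0 y') (e 1 y').
  apply: span2_sub; first exact: span2_submodule.
    by apply/he; exists x; split; ring.
  by apply/he; exists x'; split; ring.
(* The same vector [c01] is expanded on the sides A0 A1 and B0 B1 and on the axis; differences of
   these expansions give the points of intersection needed. *)
have [|a0 [a1 ca]] := (he 0 0 0 1 0 s).2; first by exists s; split; ring.
have [|b0 [b1 cb]] := (he (0 - s) 0 (1 - s) 1 0 s).2; first by exists s; split; ring.
have [|d0 [d1 cd]] := (he (s / y) s ((s - 1) / (y - 1)) s 0 s).2.
  by exists (s * (y - 1) / (y - s)); split; field; rewrite ?y0 ?y10 ?sy0.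
rewrite -/c01 -/c02 -/c12 in ca cb cd.
set A0 := e 0 0 in ca; set A1 := e 0 1 in ca.
set B0 := e _ 0 in cb; set B1 := e _ 1 in cb.
(* This vector is on A0 c02 and on A1 c12, two sides of the first triangle, hence represents the
   vertex A2. The sheared triangle is treated likewise below. *)
have [ka kaE] : exists k, a0 *: A0 - d0 *: c02 = k *: e 1 y.
  have subS := @span2_submodule R W A1 c12.
  apply: (span2_meet hR (p := A0) (q := c02) subS).
  - move=> /he[t [t0 t1]]; have {}t0 : t = 0.
      move/esym/eqP: t0; rewrite mulr0 add0r !mulf_eq0 invr_eq0 subr_eq0.
      by rewrite (negPf s1) (negPf y10) !orbF => /eqP.
    by move/eqP: t1; rewrite t0; rewrite subr0 mul1r mul0r addr0 eq_sym oner_eq0.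
  - by exists a0, (- d0); rewrite scaleNr.
  - have -> : a0 *: A0 - d0 *: c02 = d1 *: c12 - a1 *: A1.
      apply/eqP; rewrite subr_eq addrAC eq_sym subr_eq -ca cd addrC //.
    by apply: submoduleB => //; apply: submoduleZ => //; [exact: span2r|exact: span2l].
  - by apply/he; exists (y / s); split; field; rewrite ?y0 ?s0.
  - by apply/he; exists ((y - 1) / (s - 1)); split; field; rewrite ?s10 ?y10 ?s0 ?y0.
  - exact: affine_plane_neq0.
have [kb kbE] : exists k, b0 *: B0 - d0 *: c02 = k *: e (1 + y - s) y.
  have subS := @span2_submodule R W B1 c12.
  apply: (span2_meet hR (p := B0) (q := c02) subS).
  - move=> /he[t [t0 t1]]; move: t0.
    have ts : t * (s - 1) = - 1.
      by apply/eqP; rewrite -addr_eq0 [X in _ == X]t1; apply/eqP; ring.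
    have -> : (1 - t) * (1 - s) + t * ((s - 1) / (y - 1)) =
        1 - s + t * (s - 1) + t * (s - 1) / (y - 1) by ring.
    rewrite ts => /eqP; rewrite eq_sym -subr_eq0.
    set z := (X in X == 0); have -> : z = - (y - 1)^-1 by rewrite /z; ring.
    by rewrite oppr_eq0 invr_eq0 (negPf y10).
  - by exists b0, (- d0); rewrite scaleNr.
  - have -> : b0 *: B0 - d0 *: c02 = d1 *: c12 - b1 *: B1.
      apply/eqP; rewrite subr_eq addrAC eq_sym subr_eq -cb cd addrC //.
    by apply: submoduleB => //; apply: submoduleZ => //; [exact: span2r|exact: span2l].
  - by apply/he; exists (y / s); split; field; rewrite ?y0 ?s0.
  - by apply/he; exists ((y - 1) / (s - 1)); split; field; rewrite ?s10 ?y10 ?s0 ?y0.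
  - exact: affine_plane_neq0.
have hE : a0 *: A0 - b0 *: B0 = b1 *: B1 - a1 *: A1.
  by apply/eqP; rewrite subr_eq addrAC eq_sym subr_eq -ca cb addrC.
have hE' : a0 *: A0 - b0 *: B0 = ka *: e 1 y - kb *: e (1 + y - s) y.
  by rewrite -kaE -kbE opprB addrA subrK.
exists (a0 *: A0 - b0 *: B0).
  move/eqP; rewrite subr_eq0 => /eqP ab.
  have a00 : a0 != 0.
    apply/eqP => a00; move: ca; rewrite a00 scale0r add0r.
    by move=> /(affine_plane_inj he)[_ /eqP]; rewrite (negPf s1).
  have := scale_solve hR a00 (esym ab); rewrite scalerA => /(affine_plane_inj he)[/eqP].
  by rewrite sub0r eq_sym oppr_eq0 (negPf s0).
move=> y' [->|->|->].
- by apply: (row 0 (0 - s) 0); exists a0, (- b0); rewrite scaleNr.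
- by rewrite hE; apply: (row (1 - s) 0 1); exists b1, (- a1); rewrite scaleNr.
- by rewrite hE'; apply: (row 1 (1 + y - s) y); exists ka, (- kb); rewrite scaleNr.
Qed.

(** The shear handles only the heights 0, 1 and one further height. The images of the lines at
    heights 0 and 1 meet in a single point, so the points obtained for different third heights
    agree. The hypothesis on F means that |F| > 3. *)
Lemma parallels_concurrent_plane (e : F -> F -> W) : affine_plane_embedding e ->
  (forall y : F, exists s, [/\ s != 0, s != 1 & s != y]) ->
  exists h, common_point e h.
Proof.
move=> he hF.
have [y [y0 y1 _]] := hF 0; have [s [s0 s1 sy]] := hF y.
have [h h0 hP] := desargues_shear he y0 y1 s0 s1 sy.
exists h; split=> // x x' z xx'.
have zP : span2 (e 0 z) (e 1 z) h.
  have [->|z0] := eqVneq z 0; first exact/hP/Or31.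
  have [->|z1] := eqVneq z 1; first exact/hP/Or32.
  have [s' [s'0 s'1 s'z]] := hF z.
  have [k k0 kP] := desargues_shear he z0 z1 s'0 s'1 s'z.
  have [|||||||c ->] := span2_meet hR (S := span2 (e 0 1) (e 1 1)) (p := e 0 0)
    (q := e 1 0) (k := h) (k' := k) => //.
  - exact: span2_submodule.
  - by move=> /he[t [_ /eqP]]; rewrite !mulr1 subrK eq_sym oner_eq0.
  - exact/hP/Or31.
  - exact/hP/Or32.
  - exact/kP/Or31.
  - exact/kP/Or32.
  - by apply: submoduleZ; [exact: span2_submodule|exact/kP/Or33].
have xx'0 : x' - x != 0 by rewrite subr_eq0 eq_sym.
move: h zP {h0 hP}; apply: span2_sub; first exact: span2_submodule.
  by apply/he; exists (- x / (x' - x)); split; field.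
by apply/he; exists ((1 - x) / (x' - x)); split; field.
Qed.

(** Again the three spanning points may be collinear or equal, so that lines and single points are
    covered too. *)
Definition affine_space_embedding (e : F -> F -> F -> W) : Prop :=
  forall x1 y1 z1 x2 y2 z2 x3 y3 z3 x y z,
    (exists a b c, e x y z = a *: e x1 y1 z1 + b *: e x2 y2 z2 + c *: e x3 y3 z3) <->
    exists t u, [/\ x = (1 - t - u) * x1 + t * x2 + u * x3,
      y = (1 - t - u) * y1 + t * y2 + u * y3 & z = (1 - t - u) * z1 + t * z2 + u * z3].

(* The auxiliary line, outside the plane z = 0, joins (0, 0, 1) and (1, 0, 1). *)
Lemma parallels_concurrent_space (e : F -> F -> F -> W) : affine_space_embedding e ->
  affine_plane_embedding (fun x y => e x y 0) ->
  exists h, common_point (fun x y => e x y 0) h.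
Proof.
move=> he he2.
have e0 x y z : e x y z <> 0.
  move=> exyz0.
  have [|t [u [xE _ _]]] := (he (x + 1) y z (x + 1) y z (x + 1) y z x y z).1.
    by exists 0, 0, 0; rewrite exyz0 !scale0r !addr0.
  have /eqP : (1 : F) = 0 by rewrite -[LHS](addrK x) {2}xE; ring.
  by rewrite oner_eq0.
(* In a parallelogram the fourth vertex is an affine combination of the others with coefficients -1,
   1, 1; separating the terms of the two parallel sides gives a vector on both lines. *)
have meet y z y' z' : (y, z) != (y', z') -> exists k, [/\ k <> 0,
    span2 (e 0 y z) (e 1 y z) k & span2 (e 0 y' z') (e 1 y' z') k].
  move=> yz.
  have [|a [b [c eE]]] := (he 0 y z 1 y z 0 y' z' 1 y' z').2.
    by exists 1, 1; split; ring.
  exists (a *: e 0 y z + b *: e 1 y z); split; last 2 first.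
  - by exists a, b.
  - by exists (- c), 1; rewrite scaleNr scale1r eE [RHS]addrC addrK.
  move=> k0; rewrite k0 add0r in eE.
  have [|t [u [/eqP]]] := (he 0 y' z' 0 y' z' 0 y' z' 1 y' z').1.
    by exists c, 0, 0; rewrite !scale0r !addr0.
  by rewrite !mulr0 !addr0 oner_eq0.
have [|h [h0 hL hM]] := meet 0 0 0 1.
  by rewrite xpair_eqE eqxx eq_sym oner_eq0.
exists h; split=> // x x' y xx'.
(* S belongs to the plane y = 0, which contains the line L through (0, 0, 0) and the auxiliary line
   M. A parallel at height y <> 0 meets S at most once, so that its intersections with L and M
   coincide, and L and M meet only in h. *)
pose S : set W := [set w | exists a b c, w = a *: e 0 0 0 + b *: e 1 0 0 + c *: e 0 0 1].
have subS : submodule S.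
  split; first by exists 0, 0, 0; rewrite !scale0r !addr0.
  move=> a _ _ [b [c [d ->]]] [b' [c' [d' ->]]].
  exists (a * b + b'), (a * c + c'), (a * d + d').
  rewrite !scalerDr !scalerDl !scalerA addrACA; congr (_ + _); exact: addrACA.
have SL : span2 (e 0 0 0) (e 1 0 0) `<=` S.
  by move=> _ [a [b ->]]; exists a, b, 0; rewrite scale0r addr0.
have SM : span2 (e 0 0 1) (e 1 0 1) `<=` S.
  apply: span2_sub => //; first by exists 0, 0, 1; rewrite !scale0r !add0r scale1r.
  by apply/he; exists 1, 1; split; ring.
have yP : span2 (e 0 y 0) (e 1 y 0) h.
  have [->//|y0] := eqVneq y 0.
  have [|k [k0 kL ky]] := meet 0 0 y 0; first by rewrite xpair_eqE eq_sym (negPf y0).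
  have [|k' [k'0 k'M k'y]] := meet 0 1 y 0; first by rewrite xpair_eqE eq_sym (negPf y0).
  have [|||||||c kE] := span2_meet hR (S := S) (p := e 0 y 0) (q := e 1 y 0)
    (k := k) (k' := k') => //.
  - by move=> /he[t [u [_ /eqP]]]; rewrite !mulr0 !addr0 (negPf y0).
  - exact: SL.
  - exact: SM.
  have [|||||||d ->] := span2_meet hR (S := span2 (e 0 0 0) (e 1 0 0))
    (p := e 0 0 1) (q := e 1 0 1) (k := h) (k' := k) => //.
  - exact: span2_submodule.
  - case=> a [b eab]; have [|t [u [_ _ /eqP]]] := (he 0 0 0 1 0 0 1 0 0 0 0 1).1.
      by exists a, b, 0; rewrite scale0r addr0.
    by rewrite !mulr0 !addr0 oner_eq0.
  - by rewrite kE; apply: submoduleZ => //; exact: span2_submodule.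
  - by apply: submoduleZ => //; exact: span2_submodule.
have xx'0 : x' - x != 0 by rewrite subr_eq0 eq_sym.
move: h yP {h0 hL hM}; apply: span2_sub; first exact: span2_submodule.
  by apply/he2; exists (- x / (x' - x)); split; field.
by apply/he2; exists ((1 - x) / (x' - x)); split; field.
Qed.
End AffinePlane.

(** * Projective closure and linear span *)

Section ProjectiveSpan.
Variables (R : unitRingType) (hR : division_ring R) (n : nat).
Implicit Types (p q r : pg_point R n) (M : set (pg_point R n)).
Let W : lmodType R := 'rV[R]_n.+1.
Implicit Types (v w : 'rV[R]_n.+1).

Definition multiples v : set 'rV[R]_n.+1 := [set a *: v | a in [set: R]].

Lemma pg_point_eq p q : vectors p = vectors q -> p = q.
Proof.
case: p q => [X HX] [Y HY] /= XY; case: Y / XY HY => HY.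
by congr PGPoint; apply: Prop_irrelevance.
Qed.

Lemma pg_point_exists v : v != 0 -> exists p, vectors p = multiples v.
Proof. by move=> v0; exists (PGPoint (ex_intro2 _ _ v v0 erefl)). Qed.

Lemma pg_point_vectors p v : vectors p v -> v != 0 -> vectors p = multiples v.
Proof.
have [w w0 ->] := vectorsP p => -[a _ <-] aw0.
have a0 : a != 0 by apply: contraNneq aw0 => ->; rewrite scale0r.
apply/seteqP; split=> [_ [b _ <-]|_ [b _ <-]].
  by exists (b * a^-1) => //; rewrite scalerA mulrVK ?hR.
by exists (b * a) => //; rewrite scalerA.
Qed.

Lemma vectors_submodule p : submodule (vectors p : set W).
Proof.
have [w _ ->] := vectorsP p; split; first by exists 0; rewrite ?scale0r.
move=> a _ _ [b _ <-] [c _ <-]; exists (a * b + c) => //.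
by rewrite scalerDl scalerA.
Qed.

Definition span (X : set W) : set W := smallest (@submodule R W) X.

Lemma span_submodule X : submodule (span X).
Proof.
split=> [S [[S0 _] _]//|a u v Xu Xv S [subS XS]].
by apply: (proj2 subS); [exact: Xu|exact: Xv].
Qed.

Definition vectors_of M : set W := \bigcup_(p in M) vectors p.

Lemma joining_lineE p q u v : vectors p = multiples u -> vectors q = multiples v ->
  joining_line p q = [set r | vectors r `<=` span2 (u : W) v].
Proof.
move=> pE qE; rewrite /joining_line pE qE.
suff -> : [set x + y | x in multiples u & y in multiples v] = span2 (u : W) v by [].
apply/seteqP; split=> [_ [_ [a _ <-]] [_ [b _ <-]] <-|_ [a [b ->]]].
  by exists a, b.
by exists (a *: u); [exists a|exists (b *: v) => //; exists b].
Qed.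

(** Two distinct points of a line have vectors forming a basis of the span of that line. *)
Lemma span_pg_subspace S : submodule S ->
  pg_subspace [set p : pg_point R n | vectors p `<=` (S : set W)].
Proof.
move=> subS l [p [q [_ ->]]] [r [s [rs [/= lr Sr] [/= ls Ss]]]] t lt.
have [u _ pE] := vectorsP p; have [v _ qE] := vectorsP q.
have [w w0 rE] := vectorsP r; have [x x0 sE] := vectorsP s.
rewrite (joining_lineE pE qE) /= in lr ls lt.
have self (y : 'rV[R]_n.+1) : multiples y y by exists 1; rewrite ?scale1r.
have rw : vectors r w by rewrite rE; exact: self.
have sx : vectors s x by rewrite sE; exact: self.
move=> y /lt uvy; apply: (span2_sub subS (Sr _ rw) (Ss _ sx)).
apply: (span2_basis hR (lr _ rw) (ls _ sx)) uvy; first exact/eqP.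
case=> a xE; apply: rs; apply: pg_point_eq.
rewrite (pg_point_vectors (p := r) (v := x)) //.
by rewrite xE; apply: submoduleZ => //; exact: vectors_submodule.
Qed.

Lemma linear_closureE M :
  linear_closure M = [set p | vectors p `<=` span (vectors_of M)].
Proof.
apply/seteqP; split.
  apply: smallest_sub; first by apply: span_pg_subspace; exact: span_submodule.
  by move=> p Mp v pv; apply: sub_gen_smallest; exists p.
move=> p /= pM S [subS MS].
(* The vectors of points of S, together with 0, for which the condition holds vacuously. T is closed
   under sums because u + v is on the line joining the points of u and v. *)
pose T : set W := [set v | forall q, vectors q v -> v != 0 -> S q].
have subT : submodule T.
  split=> [q _|a u v Tu Tv q quv uv0]; first by rewrite eqxx.
  have [u0|u0] := eqVneq u 0.
    by move: quv uv0; rewrite u0 scaler0 add0r; exact: Tv.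
  have [a0|a0] := eqVneq a 0.
    by move: quv uv0; rewrite a0 scale0r add0r; exact: Tv.
  have [pu puE] := pg_point_exists u0.
  have self (y : 'rV[R]_n.+1) : multiples y y by exists 1; rewrite ?scale1r.
  have puu : vectors pu u by rewrite puE; exact: self.
  have Spu : S pu by exact: Tu puu u0.
  have subp := vectors_submodule pu.
  have [puv|puv] := pselect (vectors pu v).
    have -> // : q = pu; apply: pg_point_eq.
    rewrite (pg_point_vectors quv uv0) (pg_point_vectors _ uv0) //.
    exact: (proj2 subp).
  have v0 : v != 0 by apply: contra_notN puv => /eqP ->; exact: (proj1 subp).
  have [pv pvE] := pg_point_exists v0.
  have pvv : vectors pv v by rewrite pvE; exact: self.
  have Spv : S pv by exact: Tv pvv v0.
  have pq : pu <> pv by move=> pq; apply: puv; rewrite pq.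
  apply: (subS (joining_line pu pv)); first by exists pu, pv.
    exists pu, pv; rewrite (joining_lineE puE pvE).
    split=> //; split=> // w; rewrite ?puE ?pvE => -[b _ <-];
      apply: submoduleZ (span2_submodule _ _) _; (exact: span2l || exact: span2r).
  rewrite (joining_lineE puE pvE) /= (pg_point_vectors quv uv0) => _ [b _ <-].
  by apply: submoduleZ (span2_submodule _ _) _; exists a, 1; rewrite scale1r.
have [v v0 pE] := vectorsP p.
have pv : vectors p v by rewrite pE; exists 1; rewrite ?scale1r.
have MT : vectors_of M `<=` T.
  move=> w [q Mq qw] q' q'w w0; apply: MS; suff <- : q = q' by [].
  by apply: pg_point_eq; rewrite (pg_point_vectors qw w0) (pg_point_vectors q'w w0).
exact: (smallest_sub subT MT (pM v pv)).
Qed.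

End ProjectiveSpan.

(** * Quadrics through a hyperplane and contraction of its image *)

Section HyperplaneContraction.
Variables (F : fieldType) (n : nat).
Implicit Types v : 'rV[F]_n.+1.

Definition hyperplane0 : set (pg_point F n) :=
  [set p | forall v, vectors p v -> v 0 0 = 0].

Lemma product_quadratic_form (C : 'cV[F]_n.+1) :
  quadratic_form (fun v : 'rV[F]_n.+1 => v 0 0 * (v *m C) 0 0).
Proof.
have lD v w : ((v + w) *m C) 0 0 = (v *m C) 0 0 + (w *m C) 0 0.
  by rewrite mulmxDl mxE.
have lZ a v : ((a *: v) *m C) 0 0 = a * (v *m C) 0 0 by rewrite -scalemxAl mxE.
have cD (v w : 'rV[F]_n.+1) : (v + w) 0 0 = v 0 0 + w 0 0 by rewrite mxE.
have cZ a (v : 'rV[F]_n.+1) : (a *: v) 0 0 = a * v 0 0 by rewrite mxE.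
split=> [a v|]; first by rewrite lZ cZ; ring.
by split=> u a v w /=; rewrite !(lD, lZ, cD, cZ); ring.
Qed.

(** The polar form of q is evaluated at v and a combination of the vectors [row i A - v], on which q
    vanishes. The weights [D] sum to 1, so the combination is 0, while linearity gives the value - q
    v. *)
Lemma quadratic_form_vanish (q : 'rV[F]_n.+1 -> F) k (A : 'M_(k, n.+1)) v :
  quadratic_form q -> (forall w : 'rV_n.+1, w 0 0 = 0 -> q w = 0) ->
  (forall i, A i 0 = 1) -> (forall i, q (row i A) = 0) ->
  v 0 0 = 1 -> (v <= A)%MS -> q v = 0.
Proof.
move=> [_ [_ qB]] qH A1 qA v1 /submxP[D vE].
pose B w := q (v + w) - q v - q w.
pose Bl : {linear 'rV[F]_n.+1 -> F | *%R} :=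
  HB.pack B (GRing.isLinear.Build _ _ _ _ B (qB v)).
have sumD : \sum_i D 0 i = 1.
  by rewrite -v1 vE mxE; apply: eq_bigr => i _; rewrite A1 mulr1.
have vsum : v = \sum_i D 0 i *: row i A by rewrite vE mulmx_sum_row.
have : B (\sum_i D 0 i *: (row i A - v)) = - q v.
  rewrite -[B _]/(Bl _) linear_sum -[q v]mul1r -sumD mulr_suml -sumrN.
  apply: eq_bigr => i _; rewrite linearZ /= /B subrKC qA sub0r.
  by rewrite (qH (_ - v)) ?subr0 ?mulrN // !mxE A1 v1 subrr.
under eq_bigr do rewrite scalerBr.
rewrite sumrB -scaler_suml sumD scale1r -vsum subrr /B addr0 subrr sub0r.
by rewrite (qH 0) ?mxE // oppr0 => /eqP; rewrite eq_sym oppr_eq0 => /eqP.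
Qed.

(** Off the hyperplane, the quadratic closure is an affine hull: a form vanishing on the hyperplane
    and at the rows vanishes on their affine hull, and a product of two linear forms separates any
    other point. *)
Lemma quadratic_closure_hyperplane0 (pt : 'rV[F]_n.+1 -> pg_point F n)
    k (A : 'M_(k, n.+1)) v :
  (forall w, w != 0 -> vectors (pt w) = multiples w) ->
  (forall i, A i 0 = 1) -> v 0 0 = 1 ->
  quadratic_closure (hyperplane0 `|` range (fun i => pt (row i A))) (pt v) <->
  (v <= A)%MS.
Proof.
move=> ptE A1 v1.
have self (y : 'rV[F]_n.+1) : multiples y y by exists 1; rewrite ?scale1r.
have neq0 (w : 'rV[F]_n.+1) : w 0 0 = 1 -> w != 0.
  by move=> w1; apply: contra_eq_neq w1 => ->; rewrite mxE eq_sym oner_neq0.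
have v0 := neq0 _ v1; have row1 i : row i A 0 0 = 1 by rewrite mxE.
split=> [cl|vA].
  rewrite submxE; apply: contrapT => vK.
  have [j vj] : exists j, (v *m cokermx A) 0 j != 0.
    apply: contrapT => nv; apply/vK/eqP; apply/rowP => j; rewrite [RHS]mxE.
    by apply/eqP/negPn/negP => vj; apply: nv; exists j.
  (* A column of the cokernel is a linear form that vanishes on all rows of A but not at v. *)
  pose C := col j (cokermx A).
  have CE w : (w *m C) 0 0 = (w *m cokermx A) 0 j 
    by rewrite !mxE; apply: eq_bigr => i _; rewrite mxE.
  pose q (w : 'rV[F]_n.+1) := w 0 0 * (w *m C) 0 0.
  have qv : q v != 0 by rewrite /q v1 mul1r CE.
  suff : q v = 0 by move/eqP; rewrite (negPf qv).
  have {}cl := cl [set p : pg_point F n | forall v, vectors p v -> q v = 0].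
  apply: cl; last by rewrite ptE.
  split; first by left; exists q; split=> //; [exact: product_quadratic_form|exists v].
  move=> p [Hp w pw|[i _ <-] w]; first by rewrite /q (Hp _ pw) mul0r.
  rewrite ptE ?neq0 // => -[a _ <-]; rewrite /q CE -scalemxAl -row_mul mulmx_coker.
  by rewrite row0 scaler0 [X in _ * X]mxE mulr0.
move=> S [[[q [qf _ ->]]|->//] MS] w; rewrite ptE // => -[a _ <-].
rewrite (proj1 qf) (quadratic_form_vanish (A := A) qf) ?mulr0 //.
  move=> u u0; have [->|un0] := eqVneq u 0.
    by rewrite -(scale0r 0) (proj1 qf) expr0n mul0r.
  apply: (MS (pt u)); last by rewrite ptE.
  by left => z; rewrite ptE // => -[b _ <-]; rewrite mxE u0 mulr0.
move=> i; apply: (MS (pt (row i A))); last by rewrite ptE ?neq0.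
by right; exists i.
Qed.

(** Modulo the span U of the image of the hyperplane, lying in the span of that image and further
    points becomes dependence on those points alone. The representatives [phi] are arbitrary, hence
    the coefficients c are unrestricted. *)
Lemma quadratic_embedding_affine (R : unitRingType) (n' : nat)
    (nu : pg_point F n -> pg_point R n') :
  division_ring R -> quadratic_embedding nu ->
  exists (W : lmodType R) (e : 'rV[F]_n.+1 -> W),
    forall k (A : 'M_(k, n.+1)) v, (forall i, A i 0 = 1) -> v 0 0 = 1 ->
      (v <= A)%MS <-> exists c : 'I_k -> R, e v = \sum_i c i *: e (row i A).
Proof.
move=> hR [nuE _].
have [p0 _] : exists p : pg_point F n, vectors p = multiples (const_mx 1).
  by apply: pg_point_exists; apply/eqP/rowP => /(_ 0)/eqP; rewrite !mxE oner_eq0.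
have /choice[pt ptE] : forall w : 'rV[F]_n.+1, exists p : pg_point F n,
    w != 0 -> vectors p = multiples w.
  move=> w; have [->|w0] := eqVneq w 0; first by exists p0.
  by have [p pE] := pg_point_exists w0; exists p.
have /choice[phi phiE] : forall p : pg_point R n', exists w : 'rV[R]_n'.+1,
    vectors p = multiples w.
  by move=> p; have [w _ ->] := vectorsP p; exists w.
have phi_in p : vectors p (phi p) by rewrite phiE; exists 1; rewrite ?scale1r.
pose U := span (vectors_of (nu @` hyperplane0)).
have subU : submodule U := span_submodule _.
have [W [pi piE]] := submodule_quotient subU.
exists W, (fun w => pi (phi (nu (pt w)))) => k A v A1 v1.
rewrite -(quadratic_closure_hyperplane0 (pt := pt)) // nuE /= linear_closureE //=.
rewrite /preimage /=.
set M := nu @` _; have subM := span_submodule (vectors_of M).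
split=> [vM|[c vE]].
  pose S : set 'rV[R]_n'.+1 := [set w | exists c : 'I_k -> R,
    pi w = \sum_i c i *: pi (phi (nu (pt (row i A))))].
  apply: (smallest_sub _ _ (vM _ (phi_in _)) : S _).
    split; first by exists (fun=> 0); rewrite linear0 big1 // => i _; rewrite scale0r.
    move=> a u w [c cE] [d dE]; exists (fun i => a * c i + d i).
    rewrite linearP cE dE scaler_sumr -big_split /=.
    by apply: eq_bigr => i _; rewrite scalerDl scalerA.
  move=> w [_ [p [Hp|[i _ <-]] <-] pw].
    exists (fun=> 0); rewrite big1 => [|i _]; last by rewrite scale0r.
    by apply/piE; apply: sub_gen_smallest; exists (nu p) => //; exists p.
  move: pw; rewrite phiE => -[a _ <-]; exists (fun j => if j == i then a else 0).
  rewrite linearZ (bigD1 i) //= eqxx big1 ?addr0 // => j /negPf ->.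
  by rewrite scale0r.
rewrite phiE => _ [a _ <-]; apply: (submoduleZ _ subM).
have UM : U `<=` span (vectors_of M).
  apply: smallest_sub => // w [_ [p Hp <-] pw]; apply: sub_gen_smallest.
  by exists (nu p) => //; exists p => //; left.
(* The chosen vector of the image of v differs from s by an element of the kernel U. *)
set s := \sum_i c i *: phi (nu (pt (row i A))).
rewrite -[phi _](subrK s) -[_ - s]scale1r; apply: (proj2 subM).
  apply: UM; apply: (piE _).1; rewrite linearB vE linear_sum; apply/eqP; rewrite subr_eq0.
  by apply/eqP/eq_bigr => i _; rewrite linearZ.
rewrite /s; elim/big_rec: _ => [|i w _ Mw]; first exact: (proj1 subM).
apply: (proj2 subM) => //; apply: sub_gen_smallest.
by exists (nu (pt (row i A))) => //; exists (pt (row i A)) => //; right; exists i.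
Qed.
End HyperplaneContraction.

(** * Affine coordinates in dimensions two and three *)

Section AffineCharts.
Variables (F : fieldType) (n : nat) (R : unitRingType) (W : lmodType R).

(** Coordinates past the end of the list take the default value 0; for n = 2 the entry z is cut
    off. *)
Definition affine_point (x y z : F) : 'rV[F]_n.+1 := \row_j [:: 1; x; y; z]`_j.

Lemma affine_point_coord x y z i : (i <= n)%N ->
  affine_point x y z 0 (inord i) = [:: 1; x; y; z]`_i.
Proof. by move=> le_in; rewrite mxE inordK. Qed.

Lemma affine_point0 x y z : affine_point x y z 0 0 = 1.
Proof. by rewrite mxE. Qed.

Lemma affine_point_comb x1 y1 z1 x2 y2 z2 x3 y3 z3 t u :
  (1 - t - u) *: affine_point x1 y1 z1 + t *: affine_point x2 y2 z2
    + u *: affine_point x3 y3 z3 =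
  affine_point ((1 - t - u) * x1 + t * x2 + u * x3)
    ((1 - t - u) * y1 + t * y2 + u * y3) ((1 - t - u) * z1 + t * z2 + u * z3).
Proof.
apply/rowP => j; rewrite !mxE; case: j => -[|[|[|[|j]]]] _ //=; first by ring.
by rewrite !nth_nil !mulr0 !addr0.
Qed.

Variable e : 'rV[F]_n.+1 -> W.
Hypothesis eP : forall k (A : 'M_(k, n.+1)) (v : 'rV_n.+1),
  (forall i, A i 0 = 1) -> v 0 0 = 1 ->
  (v <= A)%MS <-> exists c : 'I_k -> R, e v = \sum_i c i *: e (row i A).

Lemma affine_three_points (v v1 v2 v3 : 'rV[F]_n.+1) :
  v 0 0 = 1 -> v1 0 0 = 1 -> v2 0 0 = 1 -> v3 0 0 = 1 ->
  (exists a b c, e v = a *: e v1 + b *: e v2 + c *: e v3) <->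
  exists t u, v = (1 - t - u) *: v1 + t *: v2 + u *: v3.
Proof.
move=> v0 v10 v20 v30.
pose A : 'M_(3, n.+1) := \matrix_(i < 3) [:: v1; v2; v3]`_i.
have rowA i : row i A = [:: v1; v2; v3]`_i by rewrite rowK.
have A1 i : A i 0 = 1 by rewrite mxE; case: i => -[|[|[|]]].
split=> [[a [b [c abc]]]|[t [u vE]]].
  have /submxP[D vE] : (v <= A)%MS.
    apply/eP => //; exists (fun i => [:: a; b; c]`_i).
    by rewrite !big_ord_recl big_ord0 !rowA /= abc addr0 addrA.
  move: vE; rewrite mulmx_sum_row !big_ord_recl big_ord0 !rowA /= addr0 addrA => vE.
  (* Coordinate 0 is 1 at all four vectors, so the coefficients sum to 1. *)
  move: (congr1 (fun w : 'rV[F]_n.+1 => w 0 0) vE).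
  rewrite !mxE v0 v10 v20 v30 !mulr1 => D1.
  exists (D 0 (lift 0 0)), (D 0 (lift 0 (lift 0 0))); rewrite [LHS]vE.
  by congr (_ *: _ + _ *: _ + _); rewrite D1; ring.
have [|c eE] := (eP A1 v0).1.
  apply/submxP; exists (\row_i [:: 1 - t - u; t; u]`_i).
  by rewrite mulmx_sum_row !big_ord_recl big_ord0 !rowA !mxE /= addr0 addrA.
exists (c 0), (c (lift 0 0)), (c (lift 0 (lift 0 0))).
by rewrite eE !big_ord_recl big_ord0 !rowA /= addr0 addrA.
Qed.

Lemma affine_plane_chart : (2 <= n)%N ->
  affine_plane_embedding (fun x y => e (affine_point x y 0)).
Proof.
move=> n2 x1 y1 x2 y2 x y.
have P0 := affine_point0.
(* A line is treated as a plane with its second point repeated; the two coefficients of that point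
   are added. *)
have H := affine_three_points (P0 x y 0) (P0 x1 y1 0) (P0 x2 y2 0) (P0 x2 y2 0).
split=> [[a [b eE]]|[t [xE yE]]].
  have [|t [u]] := H.1; first by exists a, b, 0; rewrite scale0r addr0.
  rewrite affine_point_comb => vE; exists (t + u).
  split.
    move: (congr1 (fun w : 'rV[F]_n.+1 => w 0 (inord 1)) vE).
    by rewrite !affine_point_coord ?(ltnW n2) //= => ->; ring.
  move: (congr1 (fun w : 'rV[F]_n.+1 => w 0 (inord 2)) vE).
  by rewrite !affine_point_coord //= => ->; ring.
have [|a [b [c ->]]] := H.2.
  exists t, 0; rewrite affine_point_comb; congr affine_point; rewrite ?xE ?yE; ring.
by exists a, (b + c); rewrite scalerDl addrA.
Qed.

Lemma affine_space_chart : (3 <= n)%N ->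
  affine_space_embedding (fun x y z => e (affine_point x y z)).
Proof.
move=> n3 x1 y1 z1 x2 y2 z2 x3 y3 z3 x y z.
rewrite affine_three_points ?affine_point0 //.
split=> -[t [u vE]]; exists t, u; last first.
  by case: vE => -> -> ->; rewrite affine_point_comb.
move: vE; rewrite affine_point_comb => vE.
have coord i := congr1 (fun w : 'rV[F]_n.+1 => w 0 (inord i)) vE.
by split; [move: (coord 1%N)|move: (coord 2%N)|move: (coord 3%N)];
  rewrite !affine_point_coord //= ?(ltnW n3) // (ltnW (ltnW n3)).
Qed.

End AffineCharts.

(** * Cardinality conditions and the embedding of fields *)

Lemma card_setT_uniq (T : choiceType) (s : seq T) :
  uniq s -> (forall x, x \in s) -> ([set: T] #= `I_(size s))%card.
Proof.
move=> us sT; have -> : [set: T] = [set` [fset x in s]%fset].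
  by apply/seteqP; split=> // x _ /=; rewrite inE sT.
by apply/card_eq_fsetP; rewrite card_fseq undup_id.
Qed.

Lemma rmorphism_subfield (F : fieldType) (R : unitRingType) (f : F -> R) :
  f 1 = 1 -> {morph f : x y / x * y} -> {morph f : x y / x + y} ->
  isomorphic_to_subfield F R.
Proof.
move=> f1 fM fD.
have f0 : f 0 = 0 by apply: (addrI (f 0)); rewrite -fD !addr0.
have fB : zmod_morphism f.
  by move=> x y; apply: (addIr (f y)); rewrite -fD !subrK.
pose mA := GRing.isZmodMorphism.Build F R f fB.
pose mM := GRing.isMonoidMorphism.Build F R f (conj f1 fM).
pose g : {rmorphism F -> R} := HB.pack f mA mM.
exists (fun y => `[< exists x, f x = y >]), g; split; last 2 first.
- exact: (fmorph_inj g).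
- by move=> y; split=> /asboolP.
- split=> [|_ _ /asboolP[x <-] /asboolP[y <-]|_ _ /asboolP[x <-] /asboolP[y <-]];
    apply/asboolP.
  + by exists 1.
  + by exists (x - y); rewrite fB.
  + by exists (x / y); apply: (fmorph_div g).
Qed.

Theorem theorem2 (F : fieldType) (F' : unitRingType) (n n' : nat)
    (hF' : division_ring F')
    (hF2 : ~ ([set: F] #<= `I_2)%card)
    (hn : (2 <= n)%N)
    (hF3 : ~ ([set: F] #= `I_3)%card \/ n <> 2%N) :
  (exists nu : pg_point F n -> pg_point F' n', quadratic_embedding nu) ->
  isomorphic_to_subfield F F'.
Proof.
case=> nu /(quadratic_embedding_affine hF')[W [e eP]].
have uniq01 : uniq [:: 0; 1 : F] by rewrite /= inE eq_sym oner_eq0.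
have [x0 [x00 x01]] : exists x0 : F, x0 != 0 /\ x0 != 1.
  apply: contrapT => nx; apply: hF2.
  suff /card_eqPle[] : ([set: F] #= `I_2)%card by [].
  apply: (card_setT_uniq uniq01) => x; rewrite !inE.
  by apply/negPn/negP; rewrite negb_or => /andP[*]; apply: nx; exists x.
have plane := affine_plane_chart eP hn.
have [[h hh] [v hv]] :
    (exists h, common_point (fun x y => e (affine_point n x y 0)) h) /\
    (exists v, common_point (fun x y => e (affine_point n y x 0)) v).
  case: hF3 => [F3|n2].
    (* If y is 0 or 1, the element x0 serves; otherwise F would consist of 0, 1, y only. *)
    have avoid (y : F) : exists s, [/\ s != 0, s != 1 & s != y].
      have [->|y0] := eqVneq y 0; first by exists x0.
      have [->|y1] := eqVneq y 1; first by exists x0.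
      apply: contrapT => ns; apply: F3; apply: (card_setT_uniq (s := [:: 0; 1; y])).
        by rewrite /= !inE !negb_or eq_sym oner_eq0 eq_sym y0 eq_sym y1.
      move=> x; rewrite !inE; apply/negPn/negP.
      by rewrite !negb_or => /and3P[*]; apply: ns; exists x.
    by split; apply: parallels_concurrent_plane => //; apply: affine_plane_flip.
  have n3 : (3 <= n)%N by rewrite ltn_neqAle hn andbT eq_sym; exact/eqP.
  have space := affine_space_chart eP n3.
  split; first exact: (parallels_concurrent_space hF' space).
  (* The vertical direction follows by exchanging the first two coordinates of the space. *)
  apply: (parallels_concurrent_space hF' (e := fun x y z => e (affine_point n y x z))).
    move=> x1 y1 z1 x2 y2 z2 x3 y3 z3 x y z.
    by rewrite (space y1 x1 z1 y2 x2 z2 y3 x3 z3 y x z); split=> -[t [u []]]; exists t, u.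
  exact: affine_plane_flip plane.
have [f [f1 fM fD]] := affine_plane_rmorphism hF' plane hh hv x00 x01.
exact: rmorphism_subfield f1 fM fD.
Qed.
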